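(* Let $G_1$ be a finite nilpotent group none of whose Sylow subgroups is cyclic or generalized quaternion, and let $G$ be a finite nilpotent group with no generalized quaternion Sylow subgroup, so that either $G=G_1$, or $G=G_1\times\mathbb{Z}_n$ with $n$ a positive integer and $\gcd(|G_1|,n)=1$. Then $\mathcal{G}_E^{**}(G)$ is disconnected if and only if $G_1$ is a $p$-group for some prime $p$.
   Context: For a group $G$, the enhanced power graph $\mathcal{G}_E(G)$ is the simple graph with vertex set $G$ in which two distinct elements $x,y$ are adjacent if and only if there is $w\in G$ with $x,y\in\langle w\rangle$. A dominating vertex of a graph is a vertex adjacent to every other vertex. The proper enhanced power graph $\mathcal{G}_E^{**}(G)$ is the induced subgraph of $\mathcal{G}_E(G)$ obtained by deleting all dominating vertices of $\mathcal{G}_E(G)$. A graph is connected if any pair of its vertices is joined by a path (so a graph with no vertices is connected), and disconnected otherwise. A group is a $p$-group if its order is $p^r$ with $r$ a positive integer (so the trivial group is not a $p$-group). $\mathbb{Z}_n$ is the cyclic group of order $n$. ''Sylow subgroups of $G$'' means Sylow $p$-subgroups for the primes $p$ dividing $|G|$. *)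

(* Defs.v *)
From mathcomp Require Import all_boot all_order all_algebra all_fingroup all_solvable.

Set Implicit Arguments.
Unset Strict Implicit.
Unset Printing Implicit Defensive.

Import GroupScope.

Section Graphs.

Variables (T : finType) (V : {set T}) (e : rel T).

Definition dominating (x : T) : bool :=
  (x \in V) && [forall y in V, (y != x) ==> e x y].

Definition dominating_vertices : {set T} := [set x | dominating x].

Definition induced : rel T := [rel x y | [&& x \in V, y \in V & e x y]].

Definition graph_connected : bool :=
  [forall x in V, forall y in V, connect induced x y].

End Graphs.

Section EnhancedPowerGraph.

Variables (gT : finGroupType) (G : {set gT}).

Definition enhanced_power_rel : rel gT :=
  [rel x y | [&& x \in G, y \in G, x != y &
               [exists w in G, (x \in <[w]>) && (y \in <[w]>)]]].

Definition proper_epg_vertices : {set gT} :=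
  G :\: dominating_vertices G enhanced_power_rel.

(* The edges are those of the subgraph induced on the remaining vertices;
   this holds vacuously when every vertex is dominating. *)
Definition proper_epg_connected : bool :=
  graph_connected proper_epg_vertices enhanced_power_rel.

End EnhancedPowerGraph.

Section SylowConditions.

Variables (gT : finGroupType) (G : {group gT}).

Definition generalized_quaternion : Prop :=
  exists2 n : nat, 2 < n & G \isog 'Q_(2 ^ n).

(* 'p.-Sylow(G) P' also holds with P trivial when p does not divide #|G|,
   so the primes are restricted to the divisors of #|G|. *)
Definition all_sylow (Q : {group gT} -> Prop) : Prop :=
  forall (p : nat) (P : {group gT}),
    prime p -> p %| #|G| -> p.-Sylow(G) P -> Q P.

(* 'p.-group G' accepts the trivial group, hence the explicit positive
   exponent. *)
Definition nontrivial_pgroup (p : nat) : Prop :=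
  exists2 r : nat, 0 < r & #|G| = (p ^ r)%N.

End SylowConditions.

(* Main.v *)
Require Import Defs.
From mathcomp Require Import all_boot all_order all_algebra all_fingroup all_solvable.

(** G is an internal direct product H \x K with H a copy of G1 and K cyclic of
    order coprime to #|H|.  A noncyclic p-group whose elements of order p
    all lie in a single cyclic subgroup is generalized quaternion
    ([prime_Ohm1P]); hence, for each prime p dividing #|H|, no cyclic subgroup
    of G contains all the elements of order p of H
    ([exists_order_prime_notin]).

    This determines the dominating vertices: they are the elements of K.  An
    element x of K lies with any h * k in the cyclic group <[h]> * K
    ([dominating_coprime_cyclic]).  If x is not in K, its order is divisible by
    some prime p dividing #|H|, so <[x]> already contains the only subgroup of
    order p that any cyclic overgroup of <[x]> can have; x is thus not adjacent
    to an element of order p outside <[x]> ([vertex_of_prime_dvd]).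

    If two primes divide #|H|, every vertex is joined to a power of prime order
    p dividing #|H|, and elements of distinct prime orders are joined because
    they commute in a nilpotent group; two elements of the same order p are
    linked through an element of another prime order.  So the graph is
    connected; it is also connected, being empty, when H is trivial
    ([connected_of_not_pgroup]).

    If H is a nontrivial p-group, the order of every vertex is divisible by p,
    and adjacent vertices have the same subgroup of order p, which is thus
    constant on connected components; as H has several such subgroups, the
    graph is disconnected ([disconnected_of_pgroup]). *)

Set Implicit Arguments.
Unset Strict Implicit.
Unset Printing Implicit Defensive.

Import GroupScope.

(** * Subgroups of prime order *)

Lemma cycle_eq_of_order (gT : finGroupType) (u v w : gT) :
  u \in <[w]> -> v \in <[w]> -> #[u] = #[v] -> <[u]> = <[v]>.
Proof.
move=> wu wv ouv; apply/eqP.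
by rewrite (eq_subG_cyclic (cycle_cyclic w)) ?cycle_subG // -!orderE ouv.
Qed.

Lemma order_prime_of_dvd (gT : finGroupType) (p : nat) (x : gT) :
  prime p -> p %| #[x] -> exists2 u, u \in <[x]> & #[u] = p.
Proof. by move=> p_pr /(Cauchy p_pr)[u xu ou]; exists u. Qed.

(** If [<[x]>] contained every element of order [p], ['Ohm_1(P)] would be a
    cyclic p-group equal to its own ['Ohm_1], hence of order [p], which only
    happens when [P] is cyclic or generalized quaternion. *)
Lemma exists_order_prime_notin (gT : finGroupType) (p : nat)
    (P : {group gT}) (x : gT) :
    prime p -> p.-group P -> ~ cyclic P -> ~ generalized_quaternion P ->
  exists y, [/\ y \in P, #[y] = p & y \notin <[x]>].
Proof.
move=> p_pr pP ncycP nquatP.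
have ntP: P :!=: 1 by apply: contra_notN ncycP => /eqP->; apply: cyclic1.
case: (pickP [pred y in P | (#[y] == p) && (y \notin <[x]>)]) => [y | none].
  by case/and3P=> Py /eqP oy xy; exists y.
have sOx: 'Ohm_1(P) \subset <[x]>.
  rewrite (OhmE 1 pP) expn1 gen_subG; apply/subsetP=> y; rewrite !inE.
  case/andP=> Py; rewrite -order_dvdn => oy.
  have /pred2P[/eqP|oyp] := (primeP p_pr).2 _ oy.
    by rewrite order_eq1 => /eqP->; apply: group1.
  by move: (none y); rewrite /= Py oyp eqxx /= => /negbFE.
have pO: p.-group 'Ohm_1(P) := pgroupS (Ohm_sub 1 P) pP.
have oO: #|'Ohm_1(P)| = p.
  rewrite -(Ohm_id 1 P); apply: Ohm1_cyclic_pgroup_prime pO _.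
    exact: cyclicS sOx (cycle_cyclic x).
  by rewrite Ohm1_eq1.
case/(prime_Ohm1P pP ntP)/orP: oO => [//|/andP[_ /eqP/quaternion_classP]].
by move/nquatP.
Qed.

Lemma exists_order_prime_notin_isog (gT gT1 : finGroupType) (p : nat)
    (G1 : {group gT1}) (H : {group gT}) (x : gT) :
    all_sylow G1 (fun P => ~ cyclic P /\ ~ generalized_quaternion P) ->
    G1 \isog H -> prime p -> p %| #|H| ->
  exists y, [/\ y \in H, #[y] = p & y \notin <[x]>].
Proof.
move=> sylG1 isoH p_pr; rewrite -(card_isog isoH) => pG1.
have [P1 sylP1] := Sylow_exists p G1; have sP1 := pHall_sub sylP1.
have [ncycP1 nquatP1] := sylG1 p P1 p_pr pG1 sylP1.
have [f injf defH] := isogP isoH.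
have isoP : P1 \isog f @* P1 by apply: sub_isog.
have [|||y [Py oy xy]] := @exists_order_prime_notin _ p (f @* P1)%G x p_pr.
- by rewrite /= morphim_pgroup // (pHall_pgroup sylP1).
- by rewrite /= (injm_cyclic injf).
- by case=> n n2 isoQ; apply: nquatP1; exists n => //; apply: isog_trans isoQ.
by exists y; split; rewrite // -defH (subsetP (morphimS f sP1)).
Qed.

(** * Dominating vertices *)

Section Vertices.

Variables (gT : finGroupType) (G : {group gT}).
Local Notation vertices := (proper_epg_vertices G).
Local Notation edges := (induced vertices (enhanced_power_rel G)).

Lemma vertex_in_group (x : gT) : x \in vertices -> x \in G.
Proof. by case/setDP. Qed.

Lemma edge_witness (x y : gT) :
    edges x y ->
  [/\ x \in vertices, y \in vertices
    & exists w, (x \in <[w]>) && (y \in <[w]>)].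
Proof.
case/and3P=> Vx Vy /and4P[_ _ _ /exists_inP[w _ xyw]].
by split=> //; exists w.
Qed.

Lemma connect_of_cycle (w x y : gT) :
    w \in G -> x \in <[w]> -> y \in <[w]> -> x \in vertices -> y \in vertices ->
  connect edges x y.
Proof.
move=> Gw wx wy Vx Vy; have [<- | neq_xy] := eqVneq x y; first exact: connect0.
apply/connect1/and3P; split=> //.
apply/and4P; split; rewrite ?vertex_in_group //.
by apply/exists_inP; exists w; rewrite ?wx.
Qed.

(** The only subgroup of order [p] of a cyclic group [<[w]>] containing [x] is
    the one in [<[x]>], so [<[w]>] does not contain [y]. *)
Lemma vertex_of_order_prime_notin (p : nat) (x y : gT) :
    prime p -> p %| #[x] -> x \in G -> y \in G -> #[y] = p -> y \notin <[x]> ->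
  x \in vertices.
Proof.
move=> p_pr px Gx Gy oy xy; rewrite inE Gx andbT inE; apply/negP=> /andP[_].
move/forall_inP/(_ y Gy)/implyP.
have neq_yx: y != x by apply: contraNneq xy => ->; apply: cycle_id.
case/(_ neq_yx)/and4P=> _ _ _ /exists_inP[w _ /andP[wx wy]].
have [u xu ou] := order_prime_of_dvd p_pr px.
have wu: u \in <[w]> by apply: subsetP xu; rewrite cycle_subG.
have uy := cycle_eq_of_order wu wy (etrans ou (esym oy)).
by case/negP: xy; rewrite -cycle_subG -uy cycle_subG.
Qed.

End Vertices.

(** * The graph of a product with a coprime cyclic factor *)

Section CyclicFactor.

Variables (gT : finGroupType) (G H K : {group gT}).
Hypotheses (defG : H \x K = G) (coHK : coprime #|H| #|K|) (cycK : cyclic K).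
Hypothesis nilG : nilpotent G.
Hypothesis escapeH : forall p x, prime p -> p %| #|H| ->
  exists y, [/\ y \in H, #[y] = p & y \notin <[x]>].

Local Notation vertices := (proper_epg_vertices G).
Local Notation edges := (induced vertices (enhanced_power_rel G)).

Let sHG : H \subset G. Proof. by case/dprod_normal2: defG => /andP[]. Qed.

(** If [c] generates [K], then [h * c] generates [<[h]> * K]. *)
Lemma dominating_coprime_cyclic (x : gT) :
  x \in K -> x \notin vertices.
Proof.
move=> Kx; have [_ defHK cHK _] := dprodP defG.
have sKG: K \subset G by case/dprod_normal2: defG => _ /andP[].
have Gx := subsetP sKG x Kx; rewrite inE Gx andbT negbK inE.
apply/andP; split=> //; apply/forall_inP=> y Gy; apply/implyP=> neq_yx.
apply/and4P; split; rewrite // 1?eq_sym //.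
move: Gy; rewrite -defHK => /mulsgP[h k Hh Kk ->{y neq_yx}].
case/cyclicP: cycK => c defK; have Kc: c \in K by rewrite defK cycle_id.
have chc: commute h c by apply/esym/(centsP cHK).
have cohc: coprime #[h] #[c].
  by rewrite (coprime_dvdl (order_dvdG Hh)) // (coprime_dvdr (order_dvdG Kc)).
apply/exists_inP; exists (h * c).
  exact: mem_mulg.
rewrite cycleM // -defK -{1}[x]mul1g !mem_mulg ?group1 //.
exact: cycle_id.
Qed.

(** [K] is a normal Hall subgroup, so it contains every element of order
    coprime to [#|H|], and elements of [K] are dominating. *)
Lemma prime_dvd_of_vertex (x : gT) :
  x \in vertices -> exists p, [/\ prime p, p %| #|H| & p %| #[x]].
Proof.
move=> Vx; have Gx := vertex_in_group Vx.
have [co_xH | not_co] := boolP (coprime #[x] #|H|); last first.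
  have gt1: 1 < gcdn #[x] #|H|.
    by rewrite ltn_neqAle eq_sym not_co gcdn_gt0 cardG_gt0 orbT.
  exists (pdiv (gcdn #[x] #|H|)); split; first exact: pdiv_prime.
    exact: dvdn_trans (pdiv_dvd _) (dvdn_gcdr _ _).
  exact: dvdn_trans (pdiv_dvd _) (dvdn_gcdl _ _).
suff Kx: x \in K by case/negP: (dominating_coprime_cyclic Kx).
have [_ defHK _ _] := dprodP defG; have [_ nKG] := dprod_normal2 defG.
have piH': \pi(#|H|)^'.-group K.
  by rewrite /pgroup -coprime_pi' ?cardG_gt0.
have [_ hallK] := coprime_mulpG_Hall defHK (pgroup_pi H) piH'.
rewrite (mem_normal_Hall hallK) // /p_elt -coprime_pi' ?cardG_gt0 //.
by rewrite coprime_sym.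
Qed.

Lemma vertex_of_prime_dvd (p : nat) (x : gT) :
  prime p -> p %| #|H| -> p %| #[x] -> x \in G -> x \in vertices.
Proof.
move=> p_pr pH px Gx; have [y [Hy oy xy]] := escapeH x p_pr pH.
exact: vertex_of_order_prime_notin (subsetP sHG y Hy) oy xy.
Qed.

Lemma connect_distinct_primes (p q : nat) (u v : gT) :
    prime p -> prime q -> p %| #|H| -> q %| #|H| -> p != q ->
    u \in G -> v \in G -> #[u] = p -> #[v] = q ->
  connect edges u v.
Proof.
move=> p_pr q_pr pH qH neq_pq Gu Gv ou ov.
have co_uv: coprime #[u] #[v] by rewrite ou ov prime_coprime // dvdn_prime2.
have cuv: commute u v.
  (* As G is nilpotent, u and v lie in its direct factors 'O_p(G) and
     'O_p^'(G), which centralise each other. *)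
  have [_ _ cOO _] := dprodP (nilpotent_pcoreC p nilG).
  apply/esym/(centsP cOO).
    rewrite (mem_normal_Hall (nilpotent_pcore_Hall p^' nilG)) ?pcore_normal //.
    by rewrite /p_elt ov pnatE // !inE eq_sym.
  rewrite (mem_normal_Hall (nilpotent_pcore_Hall p nilG)) ?pcore_normal //.
  by rewrite /p_elt ou pnat_id.
apply: (@connect_of_cycle _ _ (u * v)); rewrite ?groupM ?cycleM //.
- by rewrite -{1}[u]mulg1 mem_mulg ?cycle_id.
- by rewrite -{1}[v]mul1g mem_mulg ?cycle_id.
- by apply: (vertex_of_prime_dvd p_pr); rewrite ?ou.
- by apply: (vertex_of_prime_dvd q_pr); rewrite ?ov.
Qed.

(** Testing only the primes that divide [#|H|] lets a trivial [H] satisfy the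
    hypothesis: the graph then has no vertices. *)
Lemma connected_of_not_pgroup :
    (forall p, prime p -> p %| #|H| -> ~~ p.-group H) ->
  proper_epg_connected G.
Proof.
move=> not_pH; apply/forall_inP=> x Vx; apply/forall_inP=> y Vy.
have [p [p_pr pH px]] := prime_dvd_of_vertex Vx.
have [q [q_pr qH qy]] := prime_dvd_of_vertex Vy.
have [u xu ou] := order_prime_of_dvd p_pr px.
have [v yv ov] := order_prime_of_dvd q_pr qy.
have Gx := vertex_in_group Vx; have Gy := vertex_in_group Vy.
have Gu: u \in G by apply: subsetP xu; rewrite cycle_subG.
have Gv: v \in G by apply: subsetP yv; rewrite cycle_subG.
have Vu: u \in vertices by apply: (vertex_of_prime_dvd p_pr); rewrite ?ou.
have Vv: v \in vertices by apply: (vertex_of_prime_dvd q_pr); rewrite ?ov.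
apply: connect_trans (connect_of_cycle Gx (cycle_id x) xu Vx Vu) _.
suff uv: connect edges u v.
  exact: connect_trans uv (connect_of_cycle Gy yv (cycle_id y) Vv Vy).
have [eq_pq | neq_pq] := eqVneq p q; last first.
  exact: (connect_distinct_primes p_pr q_pr).
have [r [r_pr rH neq_rp]]: exists r, [/\ prime r, r %| #|H| & r != p].
  move: (not_pH p p_pr pH); rewrite /pgroup /pnat cardG_gt0 => /allPn[r].
  by rewrite mem_primes => /and3P[r_pr _ rH] neq_rp; exists r.
have [z Hz oz] := Cauchy r_pr rH; have Gz := subsetP sHG z Hz.
apply: (@connect_trans _ _ z).
  by apply: (connect_distinct_primes p_pr r_pr); rewrite // eq_sym.
by apply: (connect_distinct_primes r_pr q_pr); rewrite // -eq_pq.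
Qed.

(** Containing a given element [a] of order [p] propagates along edges: the
    order of the new vertex is divisible by [p], and its subgroup of order [p]
    must be [<[a]>]. *)
Lemma order_prime_in_component (p : nat) (a x y : gT) :
    prime p -> p.-group H -> #[a] = p -> connect edges x y ->
  a \in <[x]> -> a \in <[y]>.
Proof.
move=> p_pr pH oa /connectP[s path_s ->{y}].
elim: s x path_s => //= z s IHs x /andP[xz path_s] xa; apply: IHs path_s _.
have [_ Vz [w /andP[wx wz]]] := edge_witness xz.
have [q [q_pr qH qz]] := prime_dvd_of_vertex Vz.
have [u zu ou] := order_prime_of_dvd q_pr qz.
have eq_qp: q = p by apply/eqP; have := pgroupP pH q q_pr qH; rewrite inE.
have wa: a \in <[w]> by apply: subsetP xa; rewrite cycle_subG.
have wu: u \in <[w]> by apply: subsetP zu; rewrite cycle_subG.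
rewrite -cycle_subG (cycle_eq_of_order wa wu) ?cycle_subG //.
by rewrite oa ou.
Qed.

Lemma disconnected_of_pgroup (p : nat) :
  prime p -> p.-group H -> p %| #|H| -> ~~ proper_epg_connected G.
Proof.
move=> p_pr pgH pH; have [a Ha oa] := Cauchy p_pr pH.
have [b [Hb ob ab]] := escapeH a p_pr pH.
have [Ga Gb] := (subsetP sHG a Ha, subsetP sHG b Hb).
have Va: a \in vertices by apply: (vertex_of_prime_dvd p_pr); rewrite ?oa.
have Vb: b \in vertices by apply: (vertex_of_prime_dvd p_pr); rewrite ?ob.
apply/negP=> /forall_inP/(_ b Vb)/forall_inP/(_ a Va) ba.
case/negP: ab; apply: (order_prime_in_component p_pr pgH ob ba).
exact: cycle_id.
Qed.

End CyclicFactor.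

(** * Transport to an internal product *)

Lemma Zp_cyclic (n : nat) : cyclic (Zp n).
Proof.
rewrite /Zp; case: ifP => _; last exact: cyclic1.
by rewrite Zp_cycle cycle_cyclic.
Qed.

Lemma internal_decomposition (gT gT1 : finGroupType)
    (G : {group gT}) (G1 : {group gT1}) :
    G \isog G1 \/
      (exists n : nat,
        [/\ 0 < n, coprime #|G1| n & G \isog setX G1 (Zp n)]) ->
  exists H K : {group gT},
    [/\ H \x K = G, coprime #|H| #|K|, cyclic K & G1 \isog H].
Proof.
case=> [isoG | [n [n_gt0 co_n isoG]]].
  exists G, 1%G; rewrite dprodg1 cards1 coprimen1 cyclic1; split=> //.
  by rewrite isog_sym.
move: isoG; rewrite isog_sym => /isogP[f injf defG].
have sH: setX G1 1 \subset setX G1 (Zp n) by rewrite setXS ?sub1G.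
have sK: setX 1 (Zp n) \subset setX G1 (Zp n) by rewrite setXS ?sub1G.
have isoH: G1 \isog f @* setX G1 1.
  exact: isog_trans (isog_setX1 _ G1) (sub_isog sH injf).
have isoK: Zp n \isog f @* setX 1 (Zp n).
  exact: isog_trans (isog_set1X _ (Zp_group n)) (sub_isog sK injf).
exists (f @* setX G1 1)%G, (f @* setX 1 (Zp n))%G; split=> //=.
- by rewrite -defG; apply: injm_dprod => //; apply: setX_dprod.
- by rewrite -(card_isog isoH) -(card_isog isoK) card_Zp.
- by rewrite -(isog_cyclic isoK) Zp_cyclic.
Qed.

Theorem theorem2p2 (gT gT1 : finGroupType) (G : {group gT}) (G1 : {group gT1})
    (nilG1 : nilpotent G1)
    (sylG1 : all_sylow G1 (fun P => ~ cyclic P /\ ~ generalized_quaternion P))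
    (nilG : nilpotent G)
    (sylG : all_sylow G (fun P => ~ generalized_quaternion P))
    (defG : G \isog G1 \/
            exists n : nat,
              [/\ 0 < n, coprime #|G1| n & G \isog setX G1 (Zp n)]) :
  ~~ proper_epg_connected G <->
    exists2 p : nat, prime p & nontrivial_pgroup G1 p.
Proof.
have [H [K [defH coHK cycK isoH]]] := internal_decomposition defG.
have escapeH := exists_order_prime_notin_isog _ sylG1 isoH.
split=> [disc | [p p_pr [r r_gt0 oG1]]].
  have [/existsP[[p /= _] /and3P[p_pr pH pgH]] | /existsPn not_pH] :=
    boolP [exists p : 'I_(#|H|).+1, [&& prime p, p %| #|H| & p.-group H]].
  - exists p => //; have [r oH] := p_natP pgH.
    exists r; last by rewrite (card_isog isoH).
    by move: pH; rewrite oH; case: r {oH} => //; rewrite Euclid_dvd1.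
  case/negP: disc; apply: (connected_of_not_pgroup defH) => // p p_pr pH.
  have lt_pH: p < #|H|.+1 by rewrite ltnS dvdn_leq.
  by have := not_pH (Ordinal lt_pH); rewrite /= p_pr pH.
have oH: #|H| = (p ^ r)%N by rewrite -(card_isog isoH).
apply: (disconnected_of_pgroup defH coHK cycK escapeH p_pr).
  by rewrite /pgroup oH pnatX pnat_id.
by rewrite oH dvdn_exp.
Qed.
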